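(* Let $\alpha\ge0$, $\beta\in(0,\frac12]$ and $C_u\ge0$ be finite. There is a finite constant $\mathcal C^{(1/2+\alpha)}\ge0$, depending only on $C_u,T,\alpha,\beta$ and $R_\pi$, such that the following holds. Let $k\in\{0,\dots,N-1\}$ and let the finite non-negative real-valued sequences $\{u_l\}_{l\ge k}$ and $\{w_l\}_{l\ge k}$ satisfy $$u_j\le w_j+C_u\sum_{l=j+1}^{N-1}\frac{u_l\Delta_l}{(T-t_l)^{1/2-\beta}(t_l-t_j)^{1/2-\alpha}},\qquad k\le j\le N.$$ Then $$u_j\le w_j+\mathcal C^{(1/2+\alpha)}C_u\sum_{l=j+1}^{N-1}\frac{w_l\Delta_l}{(T-t_l)^{1/2-\beta}(t_l-t_j)^{1/2-\alpha}},\qquad k\le j\le N.$$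
   Context: $T>0$, and $\pi=\{0=t_0<t_1<\dots<t_N=T\}$ is a time-grid with $\Delta_i:=t_{i+1}-t_i$ and $\max_{0\le i\le N-2}\Delta_{i+1}/\Delta_i\le R_\pi$ for a fixed parameter $R_\pi>0$. Empty sums are $0$. ''Depending only on'' means in particular that the constant does not depend on the grid $\pi$ (beyond $R_\pi$ and $T$), on $N$, on $k$ or on the sequences. *)

(* Defs.v *)
From HB Require Import structures.
From mathcomp Require Import all_boot all_order all_algebra.
From mathcomp Require Import reals exp.

Set Implicit Arguments.
Unset Strict Implicit.
Unset Printing Implicit Defensive.

Import Order.TTheory GRing.Theory Num.Theory.

Local Open Scope ring_scope.

(* Only the values t 0, ..., t N are meaningful. *)
Definition time_grid (R : realType) (T : R) (N : nat) (t : nat -> R) : Prop :=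
  [/\ t 0%N = 0, t N = T & forall i : nat, (i < N)%N -> t i < t i.+1].

Definition grid_step (R : realType) (t : nat -> R) (i : nat) : R :=
  t i.+1 - t i.

(* The indices 0 <= i <= N - 2 are those with i.+1 < N; for N = 1 there are
   none and the condition is void. *)
Definition grid_ratio_le (R : realType) (N : nat) (t : nat -> R) (Rpi : R) :
    Prop :=
  forall i : nat, (i.+1 < N)%N -> grid_step t i.+1 / grid_step t i <= Rpi.

(* On a time grid both bases T - t l and t l - t j are positive for
   j < l < N, so the real powers are genuine ones; the exponent 1/2 - alpha
   may be negative. *)
Definition weighted_sum (R : realType) (T alpha beta : R) (N : nat)
    (t : nat -> R) (v : nat -> R) (j : nat) : R :=
  \sum_(j.+1 <= l < N)
    v l * grid_step t l /
      ((T - t l) `^ (2^-1 - beta) * (t l - t j) `^ (2^-1 - alpha)).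

(* Main.v *)
(* With K the kernel of the sum, step included, the resolvent of K is dominated
   by rho (j, l) = 2 exp (lam (t_l - t_j)) K (j, l) for lam large, and rho is at
   most 2 exp (lam T) K.  Indeed K + Cu K rho <= rho as soon as the convolution
   of K with exp (lam (t_m - t_l)) K (l, m) is a small multiple of
   exp (lam (t_m - t_j)) K (j, m).  To gain this small factor, one bounds
   exp (- lam x) by (lam x)^(-beta/2), which leaves a discrete Beta integral with
   exponents still below 1; it is controlled by splitting at the midpoint and
   telescoping. *)
Require Import Defs.
From HB Require Import structures.
From mathcomp Require Import all_boot all_order all_algebra.
From mathcomp Require Import ring lra.
From mathcomp Require Import reals sequences exp.

Set Implicit Arguments.
Unset Strict Implicit.
Unset Printing Implicit Defensive.

Import Order.TTheory GRing.Theory Num.Theory.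

Local Open Scope ring_scope.

(** * Inequalities for real powers and the exponential *)

Lemma powRD_gt0 (R : realType) (x r s : R) :
  0 < x -> x `^ (r + s) = x `^ r * x `^ s.
Proof. by move=> x0; rewrite powRD// (gt_eqF x0) implybT. Qed.

(** Concavity: the tangent of the power function at [y] lies above its graph. It serves to compare a
    term of a grid sum with the increment of an antiderivative. *)
Lemma powR_concave_slope (R : realType) (s x y : R) :
  0 < s <= 1 -> 0 <= x -> 0 < y ->
  s * y `^ (s - 1) * (y - x) <= y `^ s - x `^ s.
Proof.
move=> /andP[s0 s1] x0 y0.
have yE : y `^ s = y `^ (s - 1) * y.
  by rewrite -{3}(powRr1 (ltW y0)) -powRD_gt0// subrK.
have ys0 : 0 <= y `^ (s - 1) := powR_ge0 _ _.
move: x0; rewrite le_eqVlt => /orP[/eqP<-|x0].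
  by rewrite powR0 ?gt_eqF// !subr0 yE -mulrA ler_piMl// mulr_ge0// ltW.
have AE : y `^ s = x `^ s * expR (s * (ln y - ln x)).
  by rewrite /powR !gt_eqF// -expRD; congr expR; ring.
have BE : y `^ (s - 1) * x = x `^ s * expR ((1 - s) * (ln x - ln y)).
  rewrite -{1}(lnK x0) /powR !gt_eqF// -!expRD; congr expR; ring.
have A0 : 0 <= x `^ s := powR_ge0 _ _.
have A1 : x `^ s * (1 + s * (ln y - ln x)) <= y `^ s.
  by rewrite AE ler_wpM2l// expR_ge1Dx.
have B1 : x `^ s * (1 + (1 - s) * (ln x - ln y)) <= y `^ (s - 1) * x.
  by rewrite BE ler_wpM2l// expR_ge1Dx.
(* With weights [1 - s] on [A1] and [s] on [B1] the logarithms cancel, which leaves x^s <= (1 - s)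
   y^s + s y^(s-1) x. *)
have A2 : (1 - s) * (x `^ s * (1 + s * (ln y - ln x))) <= (1 - s) * y `^ s.
  by rewrite ler_wpM2l// subr_ge0.
have B2 := ler_wpM2l (ltW s0) B1.
have -> : s * y `^ (s - 1) * (y - x) = s * y `^ s - s * (y `^ (s - 1) * x).
  by rewrite yE; ring.
lra.
Qed.

(** After inversion: z^d is at most 1 or z, according to whether z <= 1, and both are below e^z. *)
Lemma expRN_le_powRN (R : realType) (d z : R) :
  0 <= d <= 1 -> 0 < z -> expR (- z) <= z `^ (- d).
Proof.
move=> /andP[d0 d1] z0.
rewrite powRN expRN lef_pV2 ?posrE ?expR_gt0 ?powR_gt0//.
have [z1|z1] := leP z 1.
  have : z `^ d <= 1 `^ d by rewrite ge0_ler_powR ?nnegrE// ltW.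
  rewrite powR1 => /le_trans; apply.
  by rewrite -expR0 ler_expR ltW.
apply: (@le_trans _ _ (z `^ 1)); first by rewrite ler_powR// ltW.
rewrite powRr1 ?ltW//; have := expR_ge1Dx z; lra.
Qed.

Lemma powRN_anti (R : realType) (p x y : R) :
  0 <= p -> 0 < x -> x <= y -> y `^ (- p) <= x `^ (- p).
Proof.
move=> p0 x0 xy; have y0 := lt_le_trans x0 xy.
by rewrite !powRN lef_pV2 ?posrE ?powR_gt0// ge0_ler_powR// nnegrE ltW.
Qed.

(** * Grid sums with power singularities at the endpoints *)

Lemma time_grid_lt (R : realType) (T : R) (N : nat) (t : nat -> R) :
  time_grid T N t -> forall i j : nat, (i < j)%N -> (j <= N)%N -> t i < t j.
Proof.
case=> _ _ tS i; elim=> // j IH; rewrite ltnS leq_eqVlt => /orP[/eqP->|ij] jN.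
  exact: tS.
by rewrite (lt_trans (IH ij (ltnW jN)))// tS.
Qed.

(* Each term is at most the integral of (t_l - s)^(-q) over its grid cell. *)
Lemma sum_powRN_right (R : realType) (T : R) (N : nat) (t : nat -> R) (q : R)
    (j l : nat) :
  time_grid T N t -> 0 <= q < 1 -> (j < l <= N)%N ->
  \sum_(j.+1 <= m < l) (t l - t m) `^ (- q) * grid_step t m
    <= (t l - t j) `^ (1 - q) / (1 - q).
Proof.
move=> tg /andP[q0 q1] /andP[jl lN]; have lt := time_grid_lt tg.
have s0 : 0 < 1 - q by rewrite subr_gt0.
pose f m := - ((t l - t m) `^ (1 - q) / (1 - q)).
apply: (@le_trans _ _ (\sum_(j.+1 <= m < l) (f m.+1 - f m))).
  apply: ler_sum_nat => m /andP[jm ml].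
  have y0 : 0 < t l - t m by rewrite subr_gt0 lt.
  (* In the last cell, [m.+1 = l] and this base is 0. *)
  have x0 : 0 <= t l - t m.+1.
    rewrite subr_ge0; move: ml; rewrite leq_eqVlt => /orP[/eqP->//|ml].
    by rewrite ltW ?lt.
  have s01 : 0 < 1 - q <= 1 by rewrite s0/=; lra.
  have := powR_concave_slope s01 x0 y0.
  have -> : f m.+1 - f m =
      ((t l - t m) `^ (1 - q) - (t l - t m.+1) `^ (1 - q)) / (1 - q).
    by rewrite /f; ring.
  rewrite ler_pdivlMr//.
  have -> : 1 - q - 1 = - q by ring.
  rewrite /grid_step; move=> H; apply: le_trans H.
  by rewrite le_eqVlt; apply/orP; left; apply/eqP; ring.
rewrite telescope_sumr// /f subrr powR0 ?gt_eqF// mul0r oppr0 add0r opprK.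
apply: ler_wpM2r; first by rewrite invr_ge0 ltW.
apply: ge0_ler_powR; rewrite ?nnegrE ?subr_ge0 ?lerD2l ?lerN2; first exact: ltW.
- move: jl; rewrite leq_eqVlt => /orP[/eqP->//|jl].
  by rewrite ltW ?lt.
- by rewrite ltW ?lt.
- by rewrite ltW// lt// (leq_trans jl lN).
Qed.

(* Here the left endpoint of a cell is the bad one; the ratio condition gives
   t_(m+1) - t_j <= (1 + Rpi) (t_m - t_j) for m > j. *)
Lemma sum_powRN_left (R : realType) (T Rpi : R) (N : nat) (t : nat -> R)
    (p : R) (j l : nat) :
  time_grid T N t -> grid_ratio_le N t Rpi -> 0 < Rpi ->
  0 <= p < 1 -> (j < l <= N)%N ->
  \sum_(j.+1 <= m < l) (t m - t j) `^ (- p) * grid_step t m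
    <= (1 + Rpi) `^ p * (t l - t j) `^ (1 - p) / (1 - p).
Proof.
move=> tg tr R0 /andP[p0 p1] /andP[jl lN]; have lt := time_grid_lt tg.
have s0 : 0 < 1 - p by rewrite subr_gt0.
have R10 : 0 < 1 + Rpi by rewrite addr_gt0.
pose c := (1 + Rpi) `^ p.
have c0 : 0 < c by rewrite powR_gt0.
pose f m := c * (t m - t j) `^ (1 - p) / (1 - p).
apply: (@le_trans _ _ (\sum_(j.+1 <= m < l) (f m.+1 - f m))).
  apply: ler_sum_nat => m /andP[jm ml].
  have mN : (m < N)%N := leq_trans ml lN.
  have x0 : 0 < t m - t j by rewrite subr_gt0 lt// ltnW.
  have y0 : 0 < t m.+1 - t j by rewrite subr_gt0 lt// ltnW.
  have D0 : 0 < grid_step t m by rewrite subr_gt0 lt.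
  have ratio : t m.+1 - t j <= (1 + Rpi) * (t m - t j).
    (* Since m > j, the cell before t_m lies inside [t_j, t_m], and the step after t_m is at most
       [Rpi] times the step before it. *)
    case: m jm ml mN x0 y0 D0 => // i; rewrite ltnS => ji _ iN x0 _ D0.
    have Di0 : 0 < grid_step t i by rewrite subr_gt0 lt// ltnW.
    have := tr i iN; rewrite ler_pdivrMr// => H.
    have tji : t j <= t i.
      move: ji; rewrite leq_eqVlt => /orP[/eqP->//|ji].
      by rewrite ltW// lt// ltnW// ltnW.
    have : Rpi * grid_step t i <= Rpi * (t i.+1 - t j).
      by apply: ler_wpM2l; [exact: ltW | rewrite /grid_step lerB].
    move: H; rewrite /grid_step; lra.
  have xp : (t m - t j) `^ (- p) <= c * (t m.+1 - t j) `^ (- p).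
    rewrite -ler_pdivrMl// /c -powRN -powRM ?(ltW R10) ?(ltW x0)//.
    exact: powRN_anti.
  have s01 : 0 < 1 - p <= 1 by rewrite s0/=; lra.
  have := powR_concave_slope s01 (ltW x0) y0.
  have -> : 1 - p - 1 = - p by ring.
  have -> : t m.+1 - t j - (t m - t j) = grid_step t m.
    by rewrite /grid_step; ring.
  move=> H; rewrite /f -mulrBl -mulrBr ler_pdivlMr//.
  apply: le_trans (ler_wpM2l (ltW c0) H).
  rewrite mulrAC [leRHS](_ : _ = (c * (t m.+1 - t j) `^ (- p) * (1 - p)) * grid_step t m).
    by rewrite ler_wpM2r ?(ltW D0)// ler_wpM2r ?(ltW s0).
  by ring.
rewrite telescope_sumr// /f -/c gerBl divr_ge0 ?(ltW s0)// mulr_ge0 ?powR_ge0// (ltW c0).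
Qed.

(** The larger of [x] and [y] is at least their mean; its power is bounded there and the other power
    is kept. This decouples the two singularities. *)
Lemma powRN_mul_split (R : realType) (p q x y : R) :
  0 <= p -> 0 <= q -> 0 < x -> 0 < y ->
  x `^ (- p) * y `^ (- q) <=
    ((x + y) / 2) `^ (- p) * y `^ (- q) + ((x + y) / 2) `^ (- q) * x `^ (- p).
Proof.
move=> p0 q0 x0 y0.
have h0 : 0 < (x + y) / 2 by lra.
have [xy|xy] := leP x y.
  rewrite mulrC (le_trans (ler_wpM2r (powR_ge0 _ _) (powRN_anti q0 h0 _)))//.
    lra.
  by rewrite lerDr mulr_ge0 ?powR_ge0.
rewrite (le_trans (ler_wpM2r (powR_ge0 _ _) (powRN_anti p0 h0 _)))//.
  lra.
by rewrite lerDl mulr_ge0 ?powR_ge0.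
Qed.

Lemma sum_powRN_ge0 (R : realType) (Rpi p q : R) :
  0 < Rpi -> 0 <= p < 1 -> 0 <= q < 1 ->
  exists2 C : R, 0 <= C &
    forall (T : R) (N : nat) (t : nat -> R) (j l : nat),
      time_grid T N t -> grid_ratio_le N t Rpi -> (j < l <= N)%N ->
      \sum_(j.+1 <= m < l)
        (t m - t j) `^ (- p) * (t l - t m) `^ (- q) * grid_step t m
        <= C * (t l - t j) `^ (1 - p - q).
Proof.
move=> R0 p01 q01; have /andP[p0 p1] := p01; have /andP[q0 q1] := q01.
exists (2^-1 `^ (- p) / (1 - q) + 2^-1 `^ (- q) * (1 + Rpi) `^ p / (1 - p)).
  by rewrite addr_ge0// divr_ge0 ?subr_ge0 ?(ltW p1) ?(ltW q1)// ?mulr_ge0 ?powR_ge0.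
move=> T N t j l tg tr /[dup] jlN /andP[jl lN]; have lt := time_grid_lt tg.
set L := t l - t j.
have L0 : 0 < L by rewrite subr_gt0 lt.
apply: (@le_trans _ _ (\sum_(j.+1 <= m < l)
   ((L / 2) `^ (- p) * ((t l - t m) `^ (- q) * grid_step t m) +
    (L / 2) `^ (- q) * ((t m - t j) `^ (- p) * grid_step t m)))).
  apply: ler_sum_nat => m /andP[jm ml].
  rewrite !mulrA -mulrDl ler_wpM2r//.
    by rewrite subr_ge0 ltW// lt// (leq_trans ml).
  have -> : L = (t m - t j) + (t l - t m) by rewrite /L; ring.
  apply: powRN_mul_split => //; rewrite subr_gt0 lt//.
  exact: ltnW (leq_trans ml lN).
rewrite big_split/= -!mulr_sumr.
have A := ler_wpM2l (powR_ge0 (L / 2) (- p)) (sum_powRN_right tg q01 jlN).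
have B := ler_wpM2l (powR_ge0 (L / 2) (- q)) (sum_powRN_left tg tr R0 p01 jlN).
apply: (le_trans (lerD A B)); rewrite -/L !powRM ?invr_ge0 ?(ltW L0)//.
have -> : L `^ (1 - p - q) = L `^ (- p) * L `^ (1 - q).
  by rewrite -powRD_gt0//; congr powR; ring.
have E : L `^ (- q) * L `^ (1 - p) = L `^ (- p) * L `^ (1 - q).
  by rewrite -!powRD_gt0//; congr powR; ring.
rewrite le_eqVlt; apply/orP; left; apply/eqP.
rewrite mulrDl; congr (_ + _); first by ring.
transitivity (2^-1 `^ (- q) * (1 + Rpi) `^ p / (1 - p) * (L `^ (- q) * L `^ (1 - p))).
  by ring.
by rewrite E.
Qed.

(** Reduces an exponent of any sign to its positive part: the remaining exponent [Num.max p 0 - p]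
    is non-negative, so its base may grow to [L]. *)
Lemma powRN_max0 (R : realType) (p x L : R) :
  0 < x -> x <= L -> x `^ (- p) <= L `^ (Num.max p 0 - p) * x `^ (- Num.max p 0).
Proof.
move=> x0 xL.
have {1}-> : - p = (Num.max p 0 - p) + - Num.max p 0 by ring.
rewrite powRD_gt0// ler_wpM2r ?powR_ge0//.
rewrite ge0_ler_powR ?nnegrE ?subr_ge0 ?le_max ?lexx// ltW//.
exact: lt_le_trans xL.
Qed.

(* Discrete analogue of the Beta integral
   \int_0^L x^(-p) (L - x)^(-q) dx = B(1 - p, 1 - q) L^(1 - p - q). *)
Lemma sum_powRN_beta (R : realType) (Rpi p q : R) :
  0 < Rpi -> p < 1 -> q < 1 ->
  exists2 C : R, 0 <= C &
    forall (T : R) (N : nat) (t : nat -> R) (j l : nat),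
      time_grid T N t -> grid_ratio_le N t Rpi -> (j < l <= N)%N ->
      \sum_(j.+1 <= m < l)
        (t m - t j) `^ (- p) * (t l - t m) `^ (- q) * grid_step t m
        <= C * (t l - t j) `^ (1 - p - q).
Proof.
move=> R0 p1 q1; set p' := Num.max p 0; set q' := Num.max q 0.
have p'01 : 0 <= p' < 1 by rewrite le_max lexx orbT gt_max p1 ltr01.
have q'01 : 0 <= q' < 1 by rewrite le_max lexx orbT gt_max q1 ltr01.
have [C C0 HC] := sum_powRN_ge0 R0 p'01 q'01.
exists C => // T N t j l tg tr /[dup] jlN /andP[jl lN]; have lt := time_grid_lt tg.
have := HC _ _ _ _ _ tg tr jlN; set L := t l - t j => H.
have L0 : 0 < L by rewrite subr_gt0 lt.
(* The powers of [L] lost in passing to positive parts restore exactly the claimed exponent. *)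
have -> : L `^ (1 - p - q) = L `^ (p' - p) * L `^ (q' - q) * L `^ (1 - p' - q').
  by rewrite -!powRD_gt0//; congr powR; ring.
rewrite mulrCA; apply: le_trans (ler_wpM2l _ H); last first.
  by rewrite mulr_ge0 ?powR_ge0.
rewrite mulr_sumr; apply: ler_sum_nat => m /andP[jm ml].
have mj : t j < t m by rewrite lt// ltnW// (leq_trans ml lN).
have lm : t m < t l by rewrite lt.
rewrite mulrA ler_wpM2r//.
  by rewrite subr_ge0 ltW// lt// (leq_trans ml).
rewrite mulrACA ler_pM ?powR_ge0//; apply: powRN_max0; rewrite ?subr_gt0//.
  by rewrite lerB// ltW.
by rewrite lerB// ltW.
Qed.

(** * Comparison with a resolvent kernel *)

(* [rho] is a supersolution of the resolvent equation rho = K + Cu K rho. *)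
Lemma discrete_gronwall (R : realType) (N k : nat) (Cu : R)
    (K rho : nat -> nat -> R) (u w : nat -> R) :
  0 <= Cu ->
  (forall j l : nat, (j < l < N)%N -> 0 <= K j l) ->
  (forall j m : nat, (j < m < N)%N ->
    K j m + Cu * \sum_(j.+1 <= l < m) K j l * rho l m <= rho j m) ->
  (forall l : nat, (k <= l <= N)%N -> 0 <= w l) ->
  (forall j : nat, (k <= j <= N)%N ->
    u j <= w j + Cu * \sum_(j.+1 <= l < N) K j l * u l) ->
  forall j : nat, (k <= j <= N)%N ->
    u j <= w j + Cu * \sum_(j.+1 <= l < N) rho j l * w l.
Proof.
move=> Cu0 K0 Hrho w0 Hu j.
(* Backward induction in [j]; at j = N the sums are empty. *)
have [n] := ubnP (N - j); elim: n j => // n IH j nj /andP[kj jN].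
apply: (le_trans (Hu j _)); first by rewrite kj.
rewrite lerD2l ler_wpM2l//.
apply: (@le_trans _ _ (\sum_(j.+1 <= l < N) (K j l * w l +
    \sum_(j.+1 <= m < N | (l < m)%N) Cu * (K j l * rho l m) * w m))).
  apply: ler_sum_nat => l /andP[jl lN].
  have jlN : (j < l < N)%N by rewrite jl lN.
  apply: (le_trans (ler_wpM2l (K0 _ _ jlN) (IH l _ _))).
  - rewrite -ltnS (leq_trans _ nj)// ltnS ltn_sub2l// (leq_trans jl)//.
    exact: ltnW.
  - by rewrite (leq_trans kj (ltnW jl)) ltnW.
  rewrite mulrDr lerD2l.
  rewrite (@big_nat_widenl _ _ _ l.+1 j.+1)//= ?(leqW jl)// !mulr_sumr.
  by apply: ler_sum => m _; rewrite le_eqVlt; apply/orP; left; apply/eqP; ring.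
(* Exchanging the sums over j < l < m makes the coefficient of [w m] equal to K + Cu K rho, which
   [Hrho] bounds. *)
rewrite big_split/= (exchange_big_dep_nat xpredT)//= -big_split/=.
apply: ler_sum_nat => m /andP[jm mN].
have jmN : (j < m < N)%N by rewrite jm mN.
have wm : 0 <= w m by rewrite w0// (leq_trans kj (ltnW jm)) ltnW.
apply: le_trans (ler_wpM2r wm (Hrho _ _ jmN)).
rewrite mulrDl lerD2l -mulr_suml ler_wpM2r// mulr_sumr.
by rewrite -(@big_nat_widen _ _ _ j.+1 m N xpredT)//= ltnW.
Qed.

(** * The kernel of the sum and its weighted convolution *)

Definition sum_kernel (R : realType) (T alpha beta : R) (t : nat -> R)
    (j l : nat) : R :=
  grid_step t l /
    ((T - t l) `^ (2^-1 - beta) * (t l - t j) `^ (2^-1 - alpha)).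

Lemma weighted_sumE (R : realType) (T alpha beta : R) (N : nat)
    (t v : nat -> R) (j : nat) :
  weighted_sum T alpha beta N t v j =
  \sum_(j.+1 <= l < N) sum_kernel T alpha beta t j l * v l.
Proof. by apply: eq_bigr => l _; rewrite -mulrA mulrC. Qed.

Lemma sum_kernelE (R : realType) (T alpha beta : R) (t : nat -> R) (j l : nat) :
  sum_kernel T alpha beta t j l =
  grid_step t l * (T - t l) `^ (- (2^-1 - beta)) *
    (t l - t j) `^ (- (2^-1 - alpha)).
Proof. by rewrite /sum_kernel invfM -!powRN mulrA. Qed.

Lemma sum_kernel_ge0 (R : realType) (T alpha beta : R) (N : nat)
    (t : nat -> R) (j l : nat) :
  time_grid T N t -> (l < N)%N -> 0 <= sum_kernel T alpha beta t j l.
Proof.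
case=> _ _ tS lN; rewrite sum_kernelE !mulr_ge0 ?powR_ge0//.
by rewrite subr_ge0 ltW// tS.
Qed.

(* The exponential weight gains a factor lam^(-beta/2) in the convolution of the
   kernel with itself, through e^(-z) <= z^(-beta/2). *)
Lemma sum_kernel_conv (R : realType) (T Rpi alpha beta : R) :
  0 < T -> 0 < Rpi -> 0 <= alpha -> 0 < beta -> beta <= 2^-1 ->
  exists2 C : R, 0 <= C &
    forall (N : nat) (t : nat -> R) (lam : R) (j m : nat),
      time_grid T N t -> grid_ratio_le N t Rpi -> 0 < lam -> (j < m < N)%N ->
      \sum_(j.+1 <= l < m) sum_kernel T alpha beta t j l *
          (expR (lam * (t m - t l)) * sum_kernel T alpha beta t l m)
      <= C * lam `^ (- (beta / 2)) *
          (expR (lam * (t m - t j)) * sum_kernel T alpha beta t j m).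
Proof.
move=> T0 R0 al0 be0 be2.
set a := 2^-1 - beta; set b := 2^-1 - alpha; set d := beta / 2.
have a0 : 0 <= a by rewrite subr_ge0.
have d01 : 0 <= d <= 1 by rewrite /d; apply/andP; split; lra.
(* Exponent at t_j: [b], raised by [d] through the exponential. Exponent at t_m: [b], raised by [a]
   because T - t_l >= t_m - t_l; it equals 1 - alpha - beta. *)
have p1 : b + d < 1 by rewrite /b /d; lra.
have q1 : a + b < 1 by rewrite /a /b; lra.
have [C C0 HC] := sum_powRN_beta R0 p1 q1.
have g0 : 0 <= alpha + beta / 2 by lra.
(* The Beta bound leaves L^(alpha + beta/2) L^(-b) with L = t_m - t_j <= T; the second factor
   returns to the kernel. *)
exists (C * T `^ (alpha + beta / 2)); first by rewrite mulr_ge0 ?powR_ge0.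
move=> N t lam j m tg tr lam0 /andP[jm mN]; have lt := time_grid_lt tg.
have jmN : (j < m <= N)%N by rewrite jm ltnW.
have [t0 tN _] := tg.
have := HC _ _ _ _ _ tg tr jmN; set L := t m - t j => H.
have L0 : 0 < L by rewrite subr_gt0 lt// ltnW.
have LT : L <= T.
  have : t m < t N by rewrite lt.
  have : 0 <= t j.
    by rewrite -t0; case: (j) jm => // i im; rewrite ltW// lt// ltnW// (ltn_trans im).
  rewrite tN /L; lra.
set Q := expR (lam * L) * (grid_step t m * (T - t m) `^ (- a)) * lam `^ (- d).
have D0 i : (i < N)%N -> 0 <= grid_step t i by move=> iN; rewrite subr_ge0 ltW// lt.
have Q0 : 0 <= Q by rewrite !mulr_ge0 ?powR_ge0 ?D0// ltW// expR_gt0.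
apply: (@le_trans _ _ (Q * (C * L `^ (1 - (b + d) - (a + b))))).
  apply: le_trans (ler_wpM2l Q0 H).
  rewrite mulr_sumr; apply: ler_sum_nat => l /andP[jl lm].
  have lN := ltn_trans lm mN.
  have x0 : 0 < t l - t j by rewrite subr_gt0 lt// ltnW.
  have y0 : 0 < t m - t l by rewrite subr_gt0 lt// ltnW.
  have yT : t m - t l <= T - t l by rewrite lerD2r -tN ltW// lt.
  rewrite !sum_kernelE -/a -/b (opprD b d) (opprD a b) !(powRD_gt0 _ _ x0) !(powRD_gt0 _ _ y0).
  (* The exponent splits as lam L - lam (t_l - t_j); only the second part is traded for a power. *)
  have E1 : expR (lam * (t m - t l)) <=
      expR (lam * L) * lam `^ (- d) * (t l - t j) `^ (- d).
    have -> : lam * (t m - t l) = lam * L + - (lam * (t l - t j)).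
      by rewrite /L; ring.
    rewrite expRD -mulrA ler_wpM2l ?(ltW (expR_gt0 _))//.
    rewrite -powRM ?(ltW lam0) ?(ltW x0)//.
    by rewrite expRN_le_powRN// mulr_gt0.
  have E2 := powRN_anti a0 y0 yT.
  have E := ler_pM (ltW (expR_gt0 _)) (powR_ge0 _ _) E1 E2.
  have G0 : 0 <= grid_step t l * (t l - t j) `^ (- b) * (grid_step t m *
      (T - t m) `^ (- a) * (t m - t l) `^ (- b)).
    by rewrite !mulr_ge0 ?powR_ge0 ?D0.
  have := ler_wpM2l G0 E.
  by apply: etrans; congr (_ <= _); rewrite /Q; ring.
have -> : 1 - (b + d) - (a + b) = (alpha + beta / 2) + (- b).
  by rewrite /a /b /d; field.
rewrite powRD_gt0// sum_kernelE -/a -/b -/L.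
have G : L `^ (alpha + beta / 2) <= T `^ (alpha + beta / 2).
  by apply: ge0_ler_powR; rewrite ?nnegrE ?(ltW L0) ?(ltW T0).
have QC0 : 0 <= Q * C * L `^ (- b) by rewrite mulr_ge0 ?powR_ge0// mulr_ge0.
have := ler_wpM2l QC0 G.
by apply: etrans; congr (_ <= _); rewrite /Q; ring.
Qed.

(** * Choice of the exponential rate and the resulting constant *)

Theorem proposition2p4 (R : realType) (T Rpi alpha beta Cu : R)
    (T_gt0 : 0 < T) (Rpi_gt0 : 0 < Rpi) (alpha_ge0 : 0 <= alpha)
    (beta_gt0 : 0 < beta) (beta_le : beta <= 2^-1) (Cu_ge0 : 0 <= Cu) :
  exists2 C : R, 0 <= C &
    forall (N : nat) (t : nat -> R),
      time_grid T N t -> grid_ratio_le N t Rpi ->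
    forall (k : nat) (u w : nat -> R), (k < N)%N ->
      (forall l : nat, (k <= l <= N)%N -> 0 <= u l) ->
      (forall l : nat, (k <= l <= N)%N -> 0 <= w l) ->
      (forall j : nat, (k <= j <= N)%N ->
        u j <= w j + Cu * weighted_sum T alpha beta N t u j) ->
    forall j : nat, (k <= j <= N)%N ->
      u j <= w j + C * Cu * weighted_sum T alpha beta N t w j.
Proof.
have [C0 C00 HC] := sum_kernel_conv T_gt0 Rpi_gt0 alpha_ge0 beta_gt0 beta_le.
(* [lam] is chosen so that lam^(-beta/2) = 1/M, hence 2 Cu C0 lam^(-beta/2) <= 1; the added 1 keeps
   [M] positive when Cu C0 = 0. *)
set M := 2 * Cu * C0 + 1.
have CC0 : 0 <= 2 * Cu * C0 by rewrite !mulr_ge0.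
have M0 : 0 < M by rewrite /M; lra.
have d0 : 0 < beta / 2 by lra.
set lam := M `^ (beta / 2)^-1.
have lam0 : 0 < lam by rewrite powR_gt0.
have lamE : lam `^ (- (beta / 2)) = M^-1.
  by rewrite -powRrM mulrN mulVf ?gt_eqF// powR_inv1// ltW.
exists (2 * expR (lam * T)); first by rewrite mulr_ge0// ltW// expR_gt0.
move=> N t tg tr k u w kN _ w0 Hu j kjN; have lt := time_grid_lt tg.
have [t0 tN _] := tg; have /andP[kj jN] := kjN.
pose K := sum_kernel T alpha beta t.
have K0 i l : (i < l < N)%N -> 0 <= K i l.
  by move=> /andP[_ lN]; exact: sum_kernel_ge0 tg lN.
pose rho i l := 2 * (expR (lam * (t l - t i)) * K i l).
have Hrho i m : (i < m < N)%N ->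
    K i m + Cu * \sum_(i.+1 <= l < m) K i l * rho l m <= rho i m.
  move=> imN; have /andP[im mN] := imN.
  have -> : \sum_(i.+1 <= l < m) K i l * rho l m = 2 *
      \sum_(i.+1 <= l < m) K i l * (expR (lam * (t m - t l)) * K l m).
    by rewrite mulr_sumr; apply: eq_bigr => l _; rewrite mulrCA.
  have := HC _ _ _ _ _ tg tr lam0 imN; rewrite lamE -/K => H.
  have Cu2 : 0 <= Cu * 2 by rewrite mulr_ge0.
  have := ler_wpM2l Cu2 H; rewrite -!mulrA => {}H.
  (* One half of [rho] dominates [K], the exponential being at least 1; the other half absorbs the
     convolution by the choice of [lam]. *)
  have -> : rho i m = expR (lam * (t m - t i)) * K i m +
      expR (lam * (t m - t i)) * K i m by rewrite /rho; ring.
  apply: lerD.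
    rewrite ler_peMl ?K0// -expR0 ler_expR mulr_ge0 ?(ltW lam0)//.
    by rewrite subr_ge0 ltW// lt// ltnW.
  apply: (le_trans H).
  have E0 : 0 <= expR (lam * (t m - t i)) * K i m.
    by rewrite mulr_ge0 ?K0// ltW// expR_gt0.
  have : 2 * Cu * C0 * M^-1 <= 1 by rewrite ler_pdivrMr// mul1r /M lerDl.
  move/(ler_wpM2r E0); rewrite mul1r.
  by apply: etrans; congr (_ <= _); ring.
have Hu' i : (k <= i <= N)%N ->
    u i <= w i + Cu * \sum_(i.+1 <= l < N) K i l * u l.
  by move=> kiN; rewrite -weighted_sumE Hu.
have := discrete_gronwall Cu_ge0 K0 Hrho w0 Hu' kjN.
move=> /le_trans; apply; rewrite lerD2l -mulrA mulrCA ler_wpM2l//.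
rewrite weighted_sumE mulr_sumr; apply: ler_sum_nat => l /andP[jl lN].
have KW0 : 0 <= K j l * w l.
  by rewrite mulr_ge0 ?K0 ?jl// w0// (leq_trans kj (ltnW jl)) ltnW.
have lT : t l - t j <= T.
  have : t l < t N by rewrite lt.
  have : 0 <= t j.
    by rewrite -t0; case: (j) jl => // i il; rewrite ltW// lt// ltnW// (ltn_trans il).
  rewrite tN; lra.
have E : expR (lam * (t l - t j)) <= expR (lam * T).
  by rewrite ler_expR ler_wpM2l ?(ltW lam0).
have := ler_wpM2l (ler0n R 2) (ler_wpM2r KW0 E).
by apply: etrans; congr (_ <= _); rewrite /rho -/(K j l); ring.
Qed.
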